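(* The category $\mathsf{SM}$ of Sugihara monoids (with all algebraic homomorphisms as morphisms) is dually equivalent to the category $\mathsf{pSS}$ of Sugihara spaces with Sugihara space morphisms.
   Context: A Sugihara monoid is an algebra $(A,\wedge,\vee,\cdot,\to,t,\neg)$ such that $(A,\wedge,\vee)$ is a distributive lattice, $(A,\cdot,t)$ is a commutative monoid, $a\cdot b\le c \iff a\le b\to c$ for all $a,b,c$, $x\cdot x=x$ for all $x$, and $\neg$ is an involution: $\neg\neg x=x$ and $x\to\neg y=y\to\neg x$. A Priestley space $(X,\le,\tau)$ is a compact space with a partial order such that whenever $x\not\le y$ there is a clopen up-set containing $x$ but not $y$; it is an Esakia space if $\downarrow U$ is clopen for every clopen $U$. A pointed Priestley (Esakia) space $(X,\le,\top,\tau)$ is a Priestley (Esakia) space with a greatest element $\top$. A pointed Kleene space is a structure $(X,\le,Q,D,\top,\tau)$ such that $(X,\le,\top,\tau)$ is a pointed Priestley space, $Q$ is a closed binary relation, $D$ is a closed subset, and for all $x,y,z$: $xQx$; ($xQy$ and $x\in D$) implies $x\le y$; ($xQy$ and $y\le z$) implies $zQx$. A Sugihara space is a pointed Kleene space $(X,\le,Q,D,\top,\tau)$ such that $(X,\le,\top,\tau)$ is a pointed Esakia space, $Q=\le\cup\ge$ (comparability), and $D$ is open. A map $\varphi$ between posets is a p-morphism if it is isotone and whenever $\varphi(x)\le z$ there is $y\ge x$ with $\varphi(y)=z$. A Sugihara space morphism $\varphi\colon X\to Y$ is a continuous p-morphism with $\varphi(\top_X)=\top_Y$, $\varphi[D_X]\subseteq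 D_Y$ and $\varphi[X\setminus D_X]\subseteq Y\setminus D_Y$.
   Formalization: Sugihara spaces are additionally required to satisfy ⊤ ∉ D, which excludes only the one-point space with D = {⊤}; with that space included, pSS has no initial object, while SM has a terminal one (the trivial monoid), so the statement would be false. *)

(* Defs.v *)
From HB Require Import structures.
From mathcomp Require Import all_boot all_order.
From mathcomp Require Import boolp classical_sets topology.

Set Implicit Arguments.
Unset Strict Implicit.
Unset Printing Implicit Defensive.

Import Order.TTheory.

Local Open Scope classical_set_scope.
Local Open Scope order_scope.

Record category := Category {
  obj :> Type ;
  hom : obj -> obj -> Type ;
  idm : forall a, hom a a ;
  comp : forall a b c, hom b c -> hom a b -> hom a c ;
  comp1m : forall a b (f : hom a b), comp (idm b) f = f ;
  compm1 : forall a b (f : hom a b), comp f (idm a) = f ;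
  compA : forall a b c d (f : hom c d) (g : hom b c) (h : hom a b),
    comp f (comp g h) = comp (comp f g) h }.

Arguments hom {C} a b : rename.
Arguments idm {C} a : rename.
Arguments comp {C a b c} f g : rename.

Definition opposite (C : category) : category :=
  @Category (obj C) (fun a b => @hom C b a) (@idm C)
    (fun a b c f g => comp g f)
    (fun a b f => compm1 f) (fun a b f => comp1m f)
    (fun a b c d f g h => esym (compA h g f)).

Record functor (C D : category) := Functor {
  fobj :> C -> D ;
  fmap : forall a b, hom a b -> hom (fobj a) (fobj b) ;
  fmap1 : forall a, fmap (idm a) = idm (fobj a) ;
  fmapM : forall a b c (f : hom b c) (g : hom a b),
    fmap (comp f g) = comp (fmap f) (fmap g) }.

Arguments fmap {C D} f {a b} _ : rename.

Definition functor_id (C : category) : functor C C :=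
  @Functor C C id (fun a b f => f) (fun a => erefl) (fun a b c f g => erefl).

Lemma functor_comp_fmap1 (C D E : category) (G : functor D E)
    (F : functor C D) (a : C) : fmap G (fmap F (idm a)) = idm (G (F a)).
Proof. by rewrite !fmap1. Qed.

Lemma functor_comp_fmapM (C D E : category) (G : functor D E)
    (F : functor C D) (a b c : C) (f : hom b c) (g : hom a b) :
  fmap G (fmap F (comp f g)) = comp (fmap G (fmap F f)) (fmap G (fmap F g)).
Proof. by rewrite !fmapM. Qed.

Definition functor_comp (C D E : category) (G : functor D E)
    (F : functor C D) : functor C E :=
  @Functor C E (fun a => G (F a)) (fun a b f => fmap G (fmap F f))
    (functor_comp_fmap1 G F) (@functor_comp_fmapM C D E G F).

Definition isomorphism (C : category) (a b : C) (f : hom a b) : Prop :=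
  exists g : hom b a, comp g f = idm a /\ comp f g = idm b.

Definition naturally_isomorphic (C D : category) (F G : functor C D) : Prop :=
  exists eta : forall a, hom (F a) (G a),
    (forall a b (f : hom a b), comp (eta b) (fmap F f) = comp (fmap G f) (eta a))
    /\ (forall a, isomorphism (eta a)).

Definition equivalent_categories (C D : category) : Prop :=
  exists (F : functor C D) (G : functor D C),
    naturally_isomorphic (functor_comp G F) (functor_id C) /\
    naturally_isomorphic (functor_comp F G) (functor_id D).

Definition dually_equivalent (C D : category) : Prop :=
  equivalent_categories (opposite C) D.

Record is_sugihara_monoid (d : Order.disp_t) (A : distrLatticeType d)
    (mul imp : A -> A -> A) (t : A) (neg : A -> A) : Prop := IsSugiharaMonoid {
  sm_mulA : associative mul ;
  sm_mulC : commutative mul ;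
  sm_mul1 : left_id t mul ;
  sm_residuation : forall a b c, (mul a b <= c) <-> (a <= imp b c) ;
  sm_idempotent : forall x, mul x x = x ;
  sm_negK : forall x, neg (neg x) = x ;
  sm_imp_neg : forall x y, imp x (neg y) = imp y (neg x) }.

Record sugihara_monoid := SugiharaMonoid {
  sm_disp : Order.disp_t ;
  sm_carrier :> distrLatticeType sm_disp ;
  sm_mul : sm_carrier -> sm_carrier -> sm_carrier ;
  sm_imp : sm_carrier -> sm_carrier -> sm_carrier ;
  sm_one : sm_carrier ;
  sm_neg : sm_carrier -> sm_carrier ;
  sm_axioms : is_sugihara_monoid sm_mul sm_imp sm_one sm_neg }.

Arguments sm_mul {s} x y : rename.
Arguments sm_imp {s} x y : rename.
Arguments sm_one {s}.
Arguments sm_neg {s} x : rename.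

Record is_sm_hom (A B : sugihara_monoid) (f : A -> B) : Prop := IsSmHom {
  smh_meet : forall x y, f (x `&` y) = f x `&` f y ;
  smh_join : forall x y, f (x `|` y) = f x `|` f y ;
  smh_mul : forall x y, f (sm_mul x y) = sm_mul (f x) (f y) ;
  smh_imp : forall x y, f (sm_imp x y) = sm_imp (f x) (f y) ;
  smh_one : f sm_one = sm_one ;
  smh_neg : forall x, f (sm_neg x) = sm_neg (f x) }.

Record sm_hom (A B : sugihara_monoid) := SmHom {
  sm_hom_fun :> A -> B ;
  sm_homP : is_sm_hom sm_hom_fun }.

Lemma sm_hom_eq (A B : sugihara_monoid) (f g : sm_hom A B) :
  (forall x, f x = g x) -> f = g.
Proof.
case: f g => [f fP] [g gP] /= /funext efg.
by case: _ / efg gP => gP; congr SmHom; apply: Prop_irrelevance.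
Qed.

Lemma is_sm_hom_id (A : sugihara_monoid) : is_sm_hom (@id A).
Proof. by split. Qed.

Lemma is_sm_hom_comp (A B C : sugihara_monoid) (f : sm_hom B C)
  (g : sm_hom A B) : is_sm_hom (f \o g).
Proof.
have fP := sm_homP f; have gP := sm_homP g.
by split=> [x y|x y|x y|x y||x] /=;
  rewrite ?(smh_meet gP, smh_join gP, smh_mul gP, smh_imp gP, smh_one gP,
    smh_neg gP) ?(smh_meet fP, smh_join fP, smh_mul fP, smh_imp fP, smh_one fP,
    smh_neg fP).
Qed.

Definition sm_id (A : sugihara_monoid) : sm_hom A A := SmHom (is_sm_hom_id A).

Definition sm_comp (A B C : sugihara_monoid) (f : sm_hom B C)
  (g : sm_hom A B) : sm_hom A C := SmHom (is_sm_hom_comp f g).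

Lemma sm_comp1m (A B : sugihara_monoid) (f : sm_hom A B) :
  sm_comp (sm_id B) f = f.
Proof. exact: sm_hom_eq. Qed.

Lemma sm_compm1 (A B : sugihara_monoid) (f : sm_hom A B) :
  sm_comp f (sm_id A) = f.
Proof. exact: sm_hom_eq. Qed.

Lemma sm_compA (A B C D : sugihara_monoid) (f : sm_hom C D) (g : sm_hom B C)
  (h : sm_hom A B) : sm_comp f (sm_comp g h) = sm_comp (sm_comp f g) h.
Proof. exact: sm_hom_eq. Qed.

Definition SM : category :=
  Category sm_comp1m sm_compm1 sm_compA.

Section spaces.
Variables (d : Order.disp_t) (X : POrderedTopological.type d).

Definition up_set (U : set X) : Prop := forall x y, x <= y -> U x -> U y.

Definition down_closure (U : set X) : set X := [set x | exists2 y, U y & x <= y].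

Definition priestley_space : Prop :=
  compact [set: X] /\
  forall x y, ~ x <= y -> exists U : set X, [/\ clopen U, up_set U, U x & ~ U y].

Definition esakia_space : Prop :=
  priestley_space /\ forall U : set X, clopen U -> clopen (down_closure U).

Definition greatest (top : X) : Prop := forall x, x <= top.

Definition pointed_priestley_space (top : X) : Prop :=
  priestley_space /\ greatest top.

Definition pointed_esakia_space (top : X) : Prop :=
  esakia_space /\ greatest top.

Record pointed_kleene_space (Q : X -> X -> Prop) (D : set X) (top : X) : Prop :=
    PointedKleeneSpace {
  pks_priestley : pointed_priestley_space top ;
  pks_Q_closed : closed [set xy : X * X | Q xy.1 xy.2] ;
  pks_D_closed : closed D ;
  pks_Q_refl : forall x, Q x x ;
  pks_D_le : forall x y, Q x y -> D x -> x <= y ;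
  pks_Q_le : forall x y z, Q x y -> y <= z -> Q z x }.

Record is_sugihara_space (Q : X -> X -> Prop) (D : set X) (top : X) : Prop :=
    IsSugiharaSpace {
  ss_kleene : pointed_kleene_space Q D top ;
  ss_esakia : pointed_esakia_space top ;
  ss_Q_comparable : forall x y, Q x y <-> (x <= y \/ y <= x) ;
  ss_D_open : open D }.

Lemma sugihara_space_top_in_D (Q : X -> X -> Prop) (D : set X) (top : X) :
  is_sugihara_space Q D top -> D top -> forall x, x = top.
Proof.
move=> [K [_ ltop] Qc _] Dt x; apply: le_anti; rewrite ltop /=.
by apply: (pks_D_le K) => //; apply/Qc; right.
Qed.

End spaces.

(** The axioms in [is_sugihara_space] admit [D top] in exactly one case, the
    one-point space with [D] full ([sugihara_space_top_in_D]). That space has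
    no morphism to or from a space where [top] is outside [D], whereas every
    Sugihara monoid maps to the trivial one; so the duality requires that [top]
    is not in [D], as in the dual of every Sugihara monoid, where the complement
    of [D] is the clopen up-set given by the constant [neg t]. *)
Record sugihara_space := SugiharaSpace {
  ss_disp : Order.disp_t ;
  ss_carrier :> POrderedTopological.type ss_disp ;
  ss_Q : ss_carrier -> ss_carrier -> Prop ;
  ss_D : set ss_carrier ;
  ss_top : ss_carrier ;
  ss_axioms : is_sugihara_space ss_Q ss_D ss_top ;
  ss_top_notin_D : ~ ss_D ss_top }.

Arguments ss_Q {s} x y : rename.
Arguments ss_D {s}.
Arguments ss_top {s}.

Definition p_morphism (d d' : Order.disp_t) (X : porderType d)
    (Y : porderType d') (f : X -> Y) : Prop :=
  {homo f : x y / x <= y} /\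
  forall x z, f x <= z -> exists2 y, x <= y & f y = z.

Record is_ss_hom (X Y : sugihara_space) (f : X -> Y) : Prop := IsSsHom {
  ssh_continuous : continuous f ;
  ssh_p_morphism : p_morphism f ;
  ssh_top : f ss_top = ss_top ;
  ssh_D : f @` ss_D `<=` ss_D ;
  ssh_notD : f @` (~` ss_D) `<=` ~` ss_D }.

Record ss_hom (X Y : sugihara_space) := SsHom {
  ss_hom_fun :> X -> Y ;
  ss_homP : is_ss_hom ss_hom_fun }.

Lemma ss_hom_eq (X Y : sugihara_space) (f g : ss_hom X Y) :
  (forall x, f x = g x) -> f = g.
Proof.
case: f g => [f fP] [g gP] /= /funext efg.
by case: _ / efg gP => gP; congr SsHom; apply: Prop_irrelevance.
Qed.

Lemma is_ss_hom_id (X : sugihara_space) : is_ss_hom (@id X).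
Proof.
split.
- by move=> x; exact: cvg_id.
- by split=> // x z xz; exists z.
- by [].
- by move=> _ [x Dx <-].
- by move=> _ [x Dx <-].
Qed.

Lemma is_ss_hom_comp (X Y Z : sugihara_space) (f : ss_hom Y Z)
  (g : ss_hom X Y) : is_ss_hom (f \o g).
Proof.
have [fc [fle fp] ft fD fnD] := ss_homP f.
have [gc [gle gp] gt gD gnD] := ss_homP g.
split.
- by move=> x; apply: continuous_comp; [exact: gc|exact: fc].
- split=> [x y xy|x z /fp[y /gp[w xw <-] <-]]; first exact/fle/gle.
  by exists w.
- by rewrite /= gt.
- by move=> _ [x Dx <-]; apply: fD; exists (g x) => //; apply: gD; exists x.
- by move=> _ [x Dx <-]; apply: fnD; exists (g x) => //; apply: gnD; exists x.
Qed.

Definition ss_id (X : sugihara_space) : ss_hom X X := SsHom (is_ss_hom_id X).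

Definition ss_comp (X Y Z : sugihara_space) (f : ss_hom Y Z)
  (g : ss_hom X Y) : ss_hom X Z := SsHom (is_ss_hom_comp f g).

Lemma ss_comp1m (X Y : sugihara_space) (f : ss_hom X Y) :
  ss_comp (ss_id Y) f = f.
Proof. exact: ss_hom_eq. Qed.

Lemma ss_compm1 (X Y : sugihara_space) (f : ss_hom X Y) :
  ss_comp f (ss_id X) = f.
Proof. exact: ss_hom_eq. Qed.

Lemma ss_compA (X Y Z W : sugihara_space) (f : ss_hom Z W) (g : ss_hom Y Z)
  (h : ss_hom X Y) : ss_comp f (ss_comp g h) = ss_comp (ss_comp f g) h.
Proof. exact: ss_hom_eq. Qed.

Definition pSS : category :=
  Category ss_comp1m ss_compm1 ss_compA.

(* Main.v *)
From HB Require Import structures.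
From mathcomp Require Import all_boot all_order.
From mathcomp Require Import boolp classical_sets topology.
Require Import Defs.

(** The dual of a Sugihara monoid [A] is the space of prime filters of [A] that
    contain [t] (the improper filter included), ordered by inclusion; [D]
    consists of the filters that omit [- t]. These are the prime filters of the
    negative cone, from which [A] is recovered by the map sending [x] to the
    pair [(x /\ t, - x /\ t)]. Conversely, the dual of a Sugihara space consists
    of the pairs [(U, V)] of clopen up-sets containing [top] that cover the space
    and meet outside [D]; negation swaps the components, and multiplication is
    read off along the chains of points above a given point, where each element
    has a constant sign up to the place from which on it vanishes. The pair
    [(phi a, phi b)] is attained by [a * - b], and every prime filter of pairs is
    given by a point because the space is compact. *)

Set Implicit Arguments.
Unset Strict Implicit.
Unset Printing Implicit Defensive.

Import Order.TTheory.

Local Open Scope classical_set_scope.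
Local Open Scope order_scope.

(** * Arithmetic of Sugihara monoids *)

Section sugihara_arithmetic.
Variable A : sugihara_monoid.
Implicit Types a b c x y z : A.

Local Notation "x * y" := (sm_mul x y) : order_scope.
Local Notation "x ~~> y" := (sm_imp x y) (at level 55, right associativity)
  : order_scope.
Local Notation "- x" := (sm_neg x) : order_scope.
Local Notation t := (@sm_one A).

Lemma mulsA x y z : x * (y * z) = x * y * z.
Proof. exact: (sm_mulA (sm_axioms A)). Qed.

Lemma mulsC x y : x * y = y * x.
Proof. exact: (sm_mulC (sm_axioms A)). Qed.

Lemma mul1s x : t * x = x.
Proof. exact: (sm_mul1 (sm_axioms A)). Qed.

Lemma muls1 x : x * t = x.
Proof. by rewrite mulsC mul1s. Qed.

Lemma mulss x : x * x = x.
Proof. exact: (sm_idempotent (sm_axioms A)). Qed.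

Lemma negsK x : - - x = x.
Proof. exact: (sm_negK (sm_axioms A)). Qed.

Lemma mulsAC x y z : x * y * z = x * z * y.
Proof. by rewrite -mulsA (mulsC y) mulsA. Qed.

Lemma mulsACA a b c x : a * b * (c * x) = a * c * (b * x).
Proof. by rewrite mulsA (mulsAC a) -mulsA. Qed.

Lemma le_imps a b c : (a <= b ~~> c) = (a * b <= c).
Proof. by apply/idP/idP => /(sm_residuation (sm_axioms A)). Qed.

Lemma le_muls a b c x : a <= b -> c <= x -> a * c <= b * x.
Proof.
move=> ab cx; rewrite -le_imps; apply: (le_trans ab).
rewrite le_imps mulsC -le_imps; apply: (le_trans cx).
by rewrite le_imps mulsC.
Qed.

Lemma muls_joinr a b c : a * (b `|` c) = a * b `|` a * c.
Proof.
apply: le_anti; apply/andP; split; last first.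
  by rewrite leUx !le_muls ?leUl ?leUr.
by rewrite mulsC -le_imps leUx !le_imps ![_ * a]mulsC leUl leUr.
Qed.

(** Contraposition turns [x ~~> - t] into [t ~~> - x], and residuation by the unit is the
    identity. *)
Lemma negs_imp x : - x = x ~~> - t.
Proof.
rewrite (sm_imp_neg (sm_axioms A)).
by apply: le_anti; rewrite le_imps muls1 lexx /= -[X in X <= _]muls1 -le_imps.
Qed.

Lemma le_negs x y : (x <= - y) = (x * y <= - t).
Proof. by rewrite negs_imp le_imps. Qed.

Lemma negs_le x y : (- x <= - y) = (y <= x).
Proof. by rewrite le_negs mulsC -le_negs negsK. Qed.

Lemma imps_neg x y : x ~~> - y = - (x * y).
Proof.
suff H c : (c <= x ~~> - y) = (c <= - (x * y)).
  by apply: le_anti; rewrite -H lexx H lexx.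
by rewrite le_imps (le_negs _ y) (le_negs _ (x * y)) mulsA.
Qed.

Lemma impsE x y : x ~~> y = - (x * - y).
Proof. by rewrite -imps_neg negsK. Qed.

Lemma negs_meet x y : - (x `&` y) = - x `|` - y.
Proof.
apply: le_anti; apply/andP; split; last by rewrite leUx !negs_le leIl leIr.
by rewrite -negs_le negsK lexI -{2}(negsK x) -{3}(negsK y) !negs_le leUl leUr.
Qed.

Lemma negs_join x y : - (x `|` y) = - x `&` - y.
Proof. by rewrite -[RHS]negsK negs_meet !negsK. Qed.

Lemma meet_le_muls x y : x `&` y <= x * y.
Proof. by rewrite -[X in X <= _]mulss le_muls ?leIl ?leIr. Qed.

Lemma muls_le_meet x y : x <= t -> y <= t -> x * y <= x `&` y.
Proof.
move=> xt yt; rewrite lexI -{2}(muls1 x) -{3}(mul1s y).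
by rewrite !le_muls.
Qed.

Lemma muls_neg_le x : x * - x <= - t.
Proof. by rewrite mulsC -le_negs. Qed.

Lemma neg_one_le : - t <= t.
Proof. by rewrite -[X in _ <= X]negsK le_negs mulss. Qed.

Lemma one_le_joinN x : t <= x `|` - x.
Proof.
rewrite -negs_le negs_join negsK meetC.
exact: le_trans (meet_le_muls _ _) (muls_neg_le _).
Qed.

(** After negation the claim bounds [x * - y /\ y * - x] by [- t]. This meet is below the product,
    which regroups into [x * - x] and [y * - y], both below [- t]. *)
Lemma imps_prelinear x y : t <= (x ~~> y) `|` (y ~~> x).
Proof.
rewrite !impsE -negs_meet -negs_le negsK.
apply: (le_trans (meet_le_muls _ _)); rewrite (mulsC y) mulsACA (mulsC (- y)).
by rewrite -[X in _ <= X]mulss le_muls ?muls_neg_le.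
Qed.

(* Splitting along [t <= x \/ - x] and [t <= y \/ - y] reduces the claim to the
   cases of a totally ordered Sugihara monoid. *)
Lemma imps_neg_ge c x y : c <= t ->
  c <= x `&` t ~~> - y -> c <= y `&` t ~~> - x -> c <= x ~~> - y.
Proof.
rewrite !imps_neg => ct; rewrite !(le_negs c) => h1 h2.
set e := c * (x * y).
have negpart z : z * (- z `&` t) <= z `&` t.
  rewrite lexI -{3}(muls1 z) le_muls ?leIr //=.
  apply: le_trans neg_one_le; apply: le_trans (muls_neg_le z).
  by rewrite le_muls ?leIl.
have part z : e <= e * (z `&` t) `|` e * (- z `&` t).
  by rewrite -muls_joinr -meetUl -{1}(muls1 e) le_muls // lexI one_le_joinN /=.
(* The summand with [- x /\ t] falls under the first hypothesis because [x * (- x /\ t) <= x /\ t];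
   the other summand is split again along [y]. *)
apply: (le_trans (part x)); rewrite leUx; apply/andP; split; last first.
  apply: le_trans h1; rewrite /e -mulsA le_muls // mulsAC le_muls //.
apply: (@le_trans _ _ (e * (x `&` t) * (y `&` t) `|` e * (- y `&` t))).
  apply: (@le_trans _ _ (e * (x `&` t) * ((y `&` t) `|` (- y `&` t)))).
    by rewrite -meetUl -{1}(muls1 (e * _)) le_muls // lexI one_le_joinN /=.
  rewrite muls_joinr leUx leUl /= lexUr //.
  by rewrite le_muls // -{2}(muls1 e) le_muls // leIr.
rewrite leUx; apply/andP; split; last first.
  apply: le_trans h2; rewrite /e -mulsA le_muls // (mulsC x) mulsAC le_muls //.
(* Idempotence of [c] doubles it, so the last summand factors into two products, each bounded by
   [- t] through one hypothesis. *)
have -> : e * (x `&` t) * (y `&` t) = c * ((x `&` t) * y) * (c * ((y `&` t) * x)).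
  rewrite (mulsACA c) mulss /e -!mulsA (mulsC (y `&` t) x) !mulsA.
  by congr (_ * _); rewrite -!mulsA; congr (_ * _); rewrite mulsC (mulsC y) -mulsA.
by rewrite -[X in _ <= X]mulss le_muls.
Qed.

End sugihara_arithmetic.

(** * Prime filters *)

Section prime_filter_theorem.
Context {d : Order.disp_t} {L : distrLatticeType d}.
Implicit Types (F I P : set L) (x y z : L).

Definition lattice_filter F :=
  (forall x y, x <= y -> F x -> F y) /\ (forall x y, F x -> F y -> F (x `&` y)).

Definition lattice_ideal I :=
  (forall x y, x <= y -> I y -> I x) /\ (forall x y, I x -> I y -> I (x `|` y)).

Definition filter_adjoin F x := [set z | exists2 c, F c & c `&` x <= z].

Lemma lattice_filter_adjoin F x : lattice_filter F ->
  lattice_filter (filter_adjoin F x).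
Proof.
move=> [Fup FI]; split=> [y z yz [c Fc cy]|y z [c Fc cy] [c' Fc' cz]].
  by exists c => //; apply: le_trans yz.
exists (c `&` c'); first exact: FI.
rewrite lexI; apply/andP; split.
  by apply: le_trans cy; rewrite leI2 ?leIl.
by apply: le_trans cz; rewrite leI2 ?leIr.
Qed.

Lemma sub_filter_adjoin F x : F `<=` filter_adjoin F x.
Proof. by move=> c Fc; exists c => //; exact: leIl. Qed.

(** Zorn's lemma gives a filter maximal among those that avoid [I]. Adjoining an outside element
    then meets [I], and distributivity turns this into primality. *)
Lemma prime_filter_separation F I x0 : lattice_filter F -> lattice_ideal I ->
    F x0 -> (forall x, F x -> ~ I x) ->
  exists P, [/\ lattice_filter P, F `<=` P, forall x, P x -> ~ I x &
    forall x y, P (x `|` y) -> P x \/ P y].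
Proof.
move=> Ffil [Idown IU] Fx0 FI0.
pose good (S : set L) :=
  [/\ lattice_filter S, forall x, S x -> ~ I x & S !=set0 -> F `<=` S].
have [|P [[Pfil PI0 FP] Pmax]] := @Zorn_bigcup _ good.
  move=> C Cgood Ctot; split.
  - split=> [x y xy [S CS Sx]|x y [S CS Sx] [S' CS' S'y]].
      by exists S => //; have [[Sup _] _ _] := Cgood S CS; exact: Sup xy Sx.
    have [SS'|S'S] := Ctot _ _ CS CS'.
      by exists S' => //; have [[_ SI] _ _] := Cgood _ CS'; apply: SI (SS' _ Sx) _.
    by exists S => //; have [[_ SI] _ _] := Cgood _ CS; apply: SI Sx (S'S _ _).
  - by move=> x [S CS Sx]; have [_ SI0 _] := Cgood S CS; exact: SI0.
  - move=> [x [S CS Sx]]; have [_ _ FS] := Cgood S CS.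
    by move=> y Fy; exists S => //; apply: FS Fy; exists x.
have {}FP : F `<=` P.
  apply: FP; apply/set0P/eqP => P0; apply: (Pmax F); last by split=> // _ x.
  by rewrite P0; split=> // /(_ x0); apply.
have Padj x : ~ P x -> exists2 c, P c & I (c `&` x).
  move=> Px; apply: contrapT => noc; apply: (Pmax (filter_adjoin P x)).
    split; first exact: sub_filter_adjoin.
    by move/(_ x) => /= h; apply/Px/h; exists x0; [exact: FP|exact: leIr].
  split; first exact: lattice_filter_adjoin.
    by move=> z [c Pc cz] Iz; apply: noc; exists c => //; exact: Idown cz Iz.
  by move=> _; apply: subset_trans FP (@sub_filter_adjoin _ _).
exists P; split=> // x y Pxy; apply: contrapT => /not_orP[/Padj[c Pc Icx]].
move=> /Padj[c' Pc' Icy]; apply: (PI0 (c `&` c' `&` (x `|` y))).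
  by apply Pfil => //; apply Pfil.
rewrite meetUr; apply: IU; [apply: Idown Icx|apply: Idown Icy].
  by rewrite leI2 ?leIl.
by rewrite leI2 ?leIr.
Qed.

End prime_filter_theorem.

(* The improper filter [setT] is allowed: it is the greatest point of the dual
   space. *)
Record is_spectrum_point (A : sugihara_monoid) (P : set A) : Prop := {
  sp_filter : lattice_filter P ;
  sp_one : P sm_one ;
  sp_prime : forall x y, P (x `|` y) -> P x \/ P y }.

Record spectrum (A : sugihara_monoid) := Spectrum {
  spectrum_set :> A -> Prop ;
  spectrumP : is_spectrum_point spectrum_set }.

HB.instance Definition _ (A : sugihara_monoid) := gen_eqMixin (spectrum A).
HB.instance Definition _ (A : sugihara_monoid) := gen_choiceMixin (spectrum A).

Lemma spectrum_eq (A : sugihara_monoid) (P P' : spectrum A) :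
  (forall x, P x <-> P' x) -> P = P'.
Proof.
case: P P' => [P p] [P' p'] /= /predeqP ePP'.
by case: _ / ePP' p' => p'; congr Spectrum; apply: Prop_irrelevance.
Qed.

(** * Order and topology of the spectrum *)

Section spectrum_order.
Variable A : sugihara_monoid.
Implicit Types P Q : spectrum A.

Fact spectrum_display : Order.disp_t. Proof. exact: Order.Disp tt tt. Qed.

Definition spectrum_le P Q := `[< spectrum_set P `<=` spectrum_set Q >].

Lemma spectrum_le_refl : reflexive spectrum_le.
Proof. by move=> P; apply/asboolP. Qed.

Lemma spectrum_le_anti : antisymmetric spectrum_le.
Proof.
move=> P Q /andP[/asboolP PQ /asboolP QP].
by apply: spectrum_eq => x; split=> [/PQ|/QP].
Qed.

Lemma spectrum_le_trans : transitive spectrum_le.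
Proof.
move=> Q P R /asboolP PQ /asboolP QR; apply/asboolP.
exact: subset_trans PQ QR.
Qed.

HB.instance Definition _ := Order.Le_isPOrder.Build spectrum_display (spectrum A)
  spectrum_le_refl spectrum_le_anti spectrum_le_trans.

Lemma spectrum_leP P Q : reflect (forall x, P x -> Q x) (P <= Q).
Proof. exact: asboolP. Qed.

(** Basic open sets of the Priestley topology. The excluded element is optional because the improper
    filter omits no element and lies only in cells with [None]. *)
Definition spectrum_cell (a : A) (o : option A) : set (spectrum A) :=
  [set P | P a /\ if o is Some b then ~ P b else True].

Definition spectrum_open (U : set (spectrum A)) := forall P, U P ->
  exists a o, spectrum_cell a o P /\ spectrum_cell a o `<=` U.

Lemma spectrum_up P x y : x <= y -> P x -> P y.
Proof. by have [[Pup _] _ _] := spectrumP P; exact: Pup. Qed.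

Lemma spectrum_one P : P sm_one. Proof. by have [] := spectrumP P. Qed.

Lemma spectrum_meet P x y : P (x `&` y) <-> P x /\ P y.
Proof.
split=> [Pxy|[Px Py]]; last by have [[_ PI] _ _] := spectrumP P; exact: PI.
by split; apply: spectrum_up Pxy; rewrite ?leIl ?leIr.
Qed.

Lemma spectrum_join P x y : P (x `|` y) <-> P x \/ P y.
Proof.
split=> [|[]]; first by have [_ _ Pp] := spectrumP P; exact: Pp.
- by apply: spectrum_up; exact: leUl.
- by apply: spectrum_up; exact: leUr.
Qed.

Lemma spectrum_cellI a b o o' : exists c q,
  (spectrum_cell a o `&` spectrum_cell b o')%classic = spectrum_cell c q.
Proof.
exists (a `&` b), (match o, o' with
  | Some x, Some y => Some (x `|` y) | Some x, None => Some x | None, _ => o' end).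
apply/predeqP => P; case: o o' => [x|] [y|] /=;
  rewrite /spectrum_cell /= spectrum_meet ?spectrum_join; tauto.
Qed.

Lemma spectrum_openT : spectrum_open setT.
Proof.
by move=> P _; exists sm_one, None; split=> //; split=> //; exact: spectrum_one.
Qed.

Lemma spectrum_openI : setI_closed spectrum_open.
Proof.
move=> U V Uo Vo P [/Uo[a [o [Pa aU]]] /Vo[b [o' [Pb bV]]]].
have [c [q cq]] := spectrum_cellI a b o o'; exists c, q; rewrite -cq.
by split=> // Q [/aU UQ /bV VQ].
Qed.

Lemma spectrum_open_bigU (I : Type) (f : I -> set (spectrum A)) :
  (forall i, spectrum_open (f i)) -> spectrum_open (\bigcup_i f i).
Proof.
move=> fo P [i _ /fo[a [o [Pa aU]]]]; exists a, o; split=> // Q /aU fQ.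
by exists i.
Qed.

HB.instance Definition _ := isOpenTopological.Build (spectrum A)
  spectrum_openT spectrum_openI spectrum_open_bigU.

Lemma spectrum_openE (U : set (spectrum A)) : open U = spectrum_open U.
Proof. by []. Qed.

End spectrum_order.

(** * Priestley spaces *)

(** If no member of [B] covered [K], the differences [K \ U] would generate a proper filter, whose
    cluster point in [K] has a neighbourhood in [B]. Closure under unions replaces the choice of a
    finite subcover. *)
Lemma compact_directed_cover (T : topologicalType) (K : set T)
    (B : set (set T)) :
  compact K -> (forall U, B U -> open U) -> B set0 ->
  (forall U V, B U -> B V -> B (U `|` V)%classic) ->
  (forall x, K x -> exists2 U, B U & U x) ->
  exists2 U, B U & K `<=` U.
Proof.
move=> Kco Bo B0 BU KB; apply: contrapT => noU.
pose F := filter_from B (fun U => (K `\` U)%classic).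
have Ffil : ProperFilter F.
  apply: filter_from_proper; first apply: filter_from_filter.
  - by exists set0.
  - move=> U V UB VB; exists (U `|` V)%classic; first exact: BU.
    by move=> x [Kx /not_orP[Ux Vx]].
  - move=> U UB; apply: contrapT => KU0; apply: noU; exists U => // x Kx.
    by apply: contrapT => Ux; apply: KU0; exists x.
have [|x [Kx xF]] := Kco F Ffil; first by exists set0 => // x [].
have [U UB Ux] := KB x Kx.
have [||y [[_ /= nUy] Uy]] := xF (K `\` U)%classic U => //; first by exists U.
exact: open_nbhs_nbhs (conj (Bo U UB) Ux).
Qed.

Section priestley.
Context {d : Order.disp_t} {X : POrderedTopological.type d}.
Hypothesis Xpr : priestley_space X.
Implicit Types (U V K : set X) (x y : X).

Lemma closed_compact_priestley K : closed K -> compact K.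
Proof. by move=> Kc; apply: subclosed_compact Kc Xpr.1 _. Qed.

Lemma priestley_hausdorff : hausdorff_space X.
Proof.
have sep x y : ~ x <= y -> cluster (nbhs x) y -> False.
  move=> /(Xpr.2)[U [[Uo Uc] _ Ux Uy]] /(_ U (~` U)%classic).
  case; [exact: open_nbhs_nbhs|exact: open_nbhs_nbhs (conj (closed_openC Uc) Uy)|].
  by move=> z [].
move=> x y clxy; apply: le_anti; apply/andP; split; apply: contrapT.
  by move=> /sep; apply.
move=> /sep; apply=> U V Ux Vy; rewrite setIC; exact: clxy.
Qed.

Lemma closed_comparability :
  closed [set xy : X * X | xy.1 <= xy.2 \/ xy.2 <= xy.1].
Proof.
suff le_closed : closed [set xy : X * X | xy.1 <= xy.2].
  have -> : [set xy : X * X | xy.1 <= xy.2 \/ xy.2 <= xy.1] =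
      ([set xy | xy.1 <= xy.2] `|` [set xy | xy.2 <= xy.1])%classic by [].
  apply: closedU => //.
  have -> : [set xy : X * X | xy.2 <= xy.1] =
     (fun xy : X * X => (xy.2, xy.1)) @^-1` [set xy : X * X | xy.1 <= xy.2].
    by [].
  apply: preimage_closed => // -[a b] _.
  by apply: cvg_pair; [exact: cvg_snd|exact: cvg_fst].
rewrite -openC openE => -[x y] /= /Xpr.2[U [[Uo Uc] Uup Ux Uy]].
exists (U, ~` U)%classic.
  split; apply: open_nbhs_nbhs; split=> //; exact: closed_openC.
by move=> [a b] /= [Ua Ub] ab; apply: Ub; exact: Uup ab Ua.
Qed.

(** A point [x] below no point of [K] is separated from each of them by a clopen up-set; compactness
    yields one open up-set around [x] that misses [K], hence also its down-closure. *)
Lemma down_closure_closed K : closed K -> closed (down_closure K).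
Proof.
move=> Kc; rewrite -openC openE => x xK.
pose B (W : set X) := open W /\ exists N : set X,
  [/\ open N, N x, up_set N & forall y, W y -> ~ N y].
have [||||W [_ [N [No Nx Nup WN]]] KW] :=
    @compact_directed_cover X K B (closed_compact_priestley Kc).
- by move=> U [].
- by split; [exact: open0|exists setT; split=> //; exact: openT].
- move=> U V [Uo [N [No Nx Nup UN]]] [Vo [N' [No' Nx' Nup' VN]]].
  split; first exact: openU.
  exists (N `&` N')%classic; split; [exact: openI|by []|..].
    by move=> a b ab [/(Nup _ _ ab) ? /(Nup' _ _ ab)].
  by move=> y [Uy [/(UN _ Uy)]|Vy [_ /(VN _ Vy)]].
- move=> y Ky; have /Xpr.2[U [[Uo Uc] Uup Ux Uy]] : ~ x <= y.
    by move=> xy; apply: xK; exists y.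
  exists (~` U)%classic => //; split; first exact: closed_openC.
  by exists U; split=> // z nUz Uz.
rewrite /interior nbhsE; exists N => // y Ny [z /KW Wz yz].
exact: WN Wz (Nup _ _ yz Ny).
Qed.

End priestley.

(** * The dual space of a Sugihara monoid *)

Section spectrum_theory.
Variable A : sugihara_monoid.
Implicit Types (P Q : spectrum A) (a b c x y z : A).

Local Notation "x * y" := (sm_mul x y) : order_scope.
Local Notation "x ~~> y" := (sm_imp x y) (at level 55, right associativity)
  : order_scope.
Local Notation "- x" := (sm_neg x) : order_scope.
Local Notation t := (@sm_one A).

Lemma spectrum_nle P Q : ~ P <= Q -> exists2 x, P x & ~ Q x.
Proof.
move=> nPQ; apply: contrapT => /forall2NP PQ; apply: nPQ; apply/spectrum_leP.
by move=> x Px; have [//|/contrapT] := PQ x.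
Qed.

Lemma spectrum_mul P x y : P x -> P y -> P (x * y).
Proof.
by move=> Px Py; apply: spectrum_up (meet_le_muls x y) _; apply/spectrum_meet.
Qed.

Lemma spectrum_em P x : P x \/ P (- x).
Proof.
by apply/spectrum_join; apply: spectrum_up (one_le_joinN x) (spectrum_one P).
Qed.

Lemma spectrum_neg_one P x : P x -> P (- x) -> P (- t).
Proof.
by move=> Px Pnx; apply: spectrum_up (muls_neg_le x) _; apply: spectrum_mul.
Qed.

Lemma spectrum_imp P x y : P (x ~~> y) -> P x -> P y.
Proof.
move=> Pxy Px; have := spectrum_mul Pxy Px; apply: spectrum_up.
by rewrite -le_imps.
Qed.

Lemma spectrum_separation (F I : set A) : lattice_filter F -> lattice_ideal I ->
  F t -> (forall x, F x -> ~ I x) ->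
  exists P, (forall x, F x -> P x) /\ (forall x, I x -> ~ P x).
Proof.
move=> Ffil Iid Ft FI.
have [P [Pfil FP PI Pp]] := prime_filter_separation Ffil Iid Ft FI.
have sP : is_spectrum_point P by split=> //; exact: FP.
exists (Spectrum sP); split=> x /=; first exact: FP.
by move=> Ix /PI; apply.
Qed.

Lemma lattice_ideal_le b : lattice_ideal [set z : A | z <= b].
Proof.
by split=> [x y xy /= yb|x y /= xb yb]; [exact: le_trans yb|rewrite leUx xb yb].
Qed.

(** The Kripke clause for implication: products below [t] are meets, so [a /\ t ~~> b] behaves like
    a Heyting implication. If the filter generated by [P] and [a] contained [b], some [c] in [P]
    would satisfy [c /\ t <= (a /\ t ~~> b)]. *)
Lemma spectrum_not_imp P a b :
  ~ P (a `&` t ~~> b) <-> exists Q, [/\ P <= Q, Q a & ~ Q b].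
Proof.
split=> [nP|[Q [/spectrum_leP PQ Qa nQb]] /PQ Qab]; last first.
  apply: nQb; apply: spectrum_imp Qab _; apply/spectrum_meet; split=> //.
  exact: spectrum_one.
have [|||z [c Pc cz] /= zb|Q [FQ IQ]] := @spectrum_separation
    (filter_adjoin (spectrum_set P) a) [set z : A | z <= b].
- apply: lattice_filter_adjoin; exact: (sp_filter (spectrumP P)).
- exact: lattice_ideal_le.
- exact/sub_filter_adjoin/spectrum_one.
- apply: nP; apply: (@spectrum_up _ P (c `&` t)); last first.
    by apply/spectrum_meet; split=> //; exact: spectrum_one.
  rewrite le_imps; apply: le_trans (muls_le_meet _ _) _; rewrite ?leIr //.
  by apply: le_trans zb; apply: le_trans cz; rewrite leI2 ?leIl.
exists Q; split; [apply/spectrum_leP => x Px|..].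
- exact/FQ/sub_filter_adjoin.
- by apply: FQ; exists t; [exact: spectrum_one|exact: leIr].
- apply: IQ; exact: lexx.
Qed.

(** By [imps_neg_ge] it suffices to find in [P] the two implications out of the negative parts of
    [x] and [y]; [spectrum_not_imp] evaluates them, and [spectrum_em] supplies the missing
    membership. *)
Lemma spectrum_negM P x y : P (- (x * y)) <->
  forall Q, P <= Q -> Q x -> Q y -> Q (- x) /\ Q (- y).
Proof.
split=> [Pxy Q /spectrum_leP PQ Qx Qy|PQ].
  have Qxy := PQ _ Pxy; split.
    by apply: spectrum_imp Qy; rewrite imps_neg mulsC.
  by apply: spectrum_imp Qx; rewrite imps_neg.
have Pimp a b : (forall Q, P <= Q -> Q a -> ~ Q (- b) -> False) ->
    P (a `&` t ~~> - b).
  move=> ab; apply: contrapT => /spectrum_not_imp[Q [PQ' Qa Qb]].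
  exact: (ab Q).
have h1 : P (x `&` t ~~> - y).
  apply: Pimp => Q PleQ Qx Qny; have [Qy|//] := spectrum_em Q y.
  by have [] := PQ Q PleQ Qx Qy.
have h2 : P (y `&` t ~~> - x).
  apply: Pimp => Q PleQ Qy Qnx; have [Qx|//] := spectrum_em Q x.
  by have [] := PQ Q PleQ Qx Qy.
rewrite -imps_neg; apply: spectrum_up
    (imps_neg_ge (c := (x `&` t ~~> - y) `&` (y `&` t ~~> - x) `&` t) _ _ _) _.
- exact: leIr.
- by rewrite -meetA leIl.
- by rewrite meetAC leIr.
- by rewrite !spectrum_meet; do !split=> //; exact: spectrum_one.
Qed.

(** A point with both [x * y] and its negation contains their product, which lies below [x] and
    below [y]; [spectrum_negM] then adds [- x] and [- y]. *)
Lemma spectrum_mulE P x y : P (x * y) <->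
  [/\ P x, P (- x), P y & P (- y)] \/ ~ P (- (x * y)).
Proof.
split=> [Pxy|[[Px _ Py _]|nP]]; last first.
- by have [|//] := spectrum_em P (x * y).
- exact: spectrum_mul.
have [Pnxy|?] := pselect (P (- (x * y))); [left|by right].
have Pe := spectrum_mul Pxy Pnxy.
have e1 u v : u * v * - (u * v) <= u.
  rewrite -{1}(mulss u) -!mulsA -[X in _ <= X]muls1 le_muls // !mulsA.
  exact: le_trans (muls_neg_le _) (neg_one_le _).
have Px : P x by apply: spectrum_up Pe.
have Py : P y by apply: spectrum_up Pe; rewrite (mulsC x).
have /spectrum_negM/(_ P (lexx _) Px Py)[Pnx Pny] := Pnxy.
by split.
Qed.

(** If [t <= x ~~> y] failed, some point would omit [x ~~> y], that is [- (x * - y)], against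
    [spectrum_negM]. This makes the unit of the duality injective. *)
Lemma spectrum_le_neg x y :
  (forall P, P x -> P y) -> (forall P, P (- y) -> P (- x)) -> x <= y.
Proof.
move=> xy nyx; suff : t <= x ~~> y by rewrite le_imps mul1s.
apply: contrapT => ntxy.
have [|||z /= tz zxy|P [tP]] := @spectrum_separation
  [set z : A | t <= z] [set z : A | z <= x ~~> y].
- by split=> [u v uv /= tu|u v /= tu tv]; [exact: le_trans uv|rewrite lexI tu tv].
- exact: lattice_ideal_le.
- exact: lexx.
- by apply: ntxy; exact: le_trans zxy.
- move/(_ (x ~~> y)) => nP; apply: nP; first exact: lexx.
  rewrite impsE; apply/spectrum_negM => Q _ Qx Qny.
  by rewrite negsK; split; [exact: nyx|exact: xy].
Qed.

(** As [x <= t], the filter above [x] contains [t], so a prime filter that separates it from [y] is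
    a point of the spectrum. *)
Lemma spectrum_le_negative x y : x <= t -> (forall P, P x -> P y) -> x <= y.
Proof.
move=> xt xy; apply: contrapT => nxy.
have [|||z /= tz zxy|P [xP]] := @spectrum_separation
  [set z : A | x <= z] [set z : A | z <= y].
- by split=> [u v uv /= tu|u v /= tu tv]; [exact: le_trans uv|rewrite lexI tu tv].
- exact: lattice_ideal_le.
- exact: xt.
- by apply: nxy; exact: le_trans zxy.
- by move=> /(_ y (lexx _)); apply; apply/xy/xP/lexx.
Qed.

Lemma open_spectrum_basic a : open [set P : spectrum A | P a].
Proof.
rewrite spectrum_openE => P Pa; exists a, None; split=> //.
by move=> Q [].
Qed.

Lemma clopen_spectrum_basic a : clopen [set P : spectrum A | P a].
Proof.
split; first exact: open_spectrum_basic.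
rewrite -openC spectrum_openE => P nPa; exists t, (Some a).
by split=> [|Q []//]; split=> //; exact: spectrum_one.
Qed.

Lemma up_set_spectrum_basic a : up_set [set P : spectrum A | P a].
Proof. by move=> P Q /spectrum_leP PQ /PQ. Qed.

Lemma spectrum_compact : compact [set: spectrum A].
Proof.
rewrite compact_ultra => F FU _.
(* The limit of the ultrafilter: the elements whose basic open set belongs to it. *)
pose p : set A := [set a | F [set P : spectrum A | P a]].
have pP : is_spectrum_point p.
  split; first split.
  - by move=> x y xy; apply: filterS => P; exact: spectrum_up.
  - move=> x y Fx Fy; rewrite /p /=; apply: filterS (filterI Fx Fy).
    by move=> P /spectrum_meet.
  - by apply: filterS filterT => P _; exact: spectrum_one.
  - move=> x y Fxy; have [|Fnx] := in_ultra_setVsetC [set P : spectrum A | P x] FU.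
      by left.
    right; apply: filterS (filterI Fxy Fnx) => P [/spectrum_join[]//].
exists (Spectrum pP); split=> // N; rewrite nbhsE => -[U [Uo Up] UN].
have [a [o [[pa po] aU]]] := Uo _ Up.
apply: filterS UN _; apply: filterS aU _; case: o po => [b|] /= pb.
  have [//|Fnb] := in_ultra_setVsetC [set P : spectrum A | P b] FU.
  by apply: filterS (filterI pa Fnb) => P [].
by apply: filterS pa.
Qed.

Lemma spectrum_priestley : priestley_space (spectrum A).
Proof.
split=> [|P Q /spectrum_nle[x Px Qx]]; first exact: spectrum_compact.
exists [set R : spectrum A | R x]; split=> //; first exact: clopen_spectrum_basic.
exact: up_set_spectrum_basic.
Qed.

Lemma spectrum_top_subproof : is_spectrum_point [set: A].
Proof. by split=> // x y _; left. Qed.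

Definition spectrum_top : spectrum A := Spectrum spectrum_top_subproof.

(** By [spectrum_not_imp] the down-closure of the cell of [a] and [b] is the complement of the basic
    set of [a /\ t ~~> b]. A cell without excluded element contains the top, so its down-closure is
    everything. *)
Lemma spectrum_esakia : esakia_space (spectrum A).
Proof.
split=> [|U [Uo Uc]]; first exact: spectrum_priestley.
split; last exact: (down_closure_closed spectrum_priestley Uc).
rewrite openE => P [Q UQ PQ].
have [a [o [[Qa Qo] aU]]] := Uo _ UQ.
rewrite /interior nbhsE; case: o Qo aU => [b|] /= Qb aU.
  exists (~` [set R : spectrum A | R (a `&` t ~~> b)%O])%classic.
    split; first by apply: closed_openC; case: (clopen_spectrum_basic (a `&` t ~~> b)).
    by apply/spectrum_not_imp; exists Q.
  by move=> R /spectrum_not_imp[S [RS Sa Sb]]; exists S => //; apply: aU.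
exists setT; first by split=> //; exact: openT.
move=> R _; exists spectrum_top; last exact/spectrum_leP.
exact: aU.
Qed.

Definition spectrum_Q P Q : Prop := P <= Q \/ Q <= P.

Definition spectrum_D : set (spectrum A) := [set P | ~ P (- t)].

(** Every point contains [x] or [- x], and a point of [D] never contains both. *)
Lemma spectrum_D_minimal P Q : spectrum_D P -> Q <= P -> P <= Q.
Proof.
move=> DP /spectrum_leP QP; apply/spectrum_leP => x Px.
have [//|/QP Pnx] := spectrum_em Q x.
by case: DP; exact: spectrum_neg_one Px Pnx.
Qed.

Lemma spectrum_root_system P Q R : P <= Q -> P <= R -> spectrum_Q Q R.
Proof.
move=> /spectrum_leP PQ /spectrum_leP PR; apply: contrapT => /not_orP[].
move=> /spectrum_nle[x Qx Rx] /spectrum_nle[y Ry Qy].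
have /spectrum_join[/PQ Qxy|/PR Rxy] :
    P ((x ~~> y) `|` (y ~~> x)).
- exact: spectrum_up (imps_prelinear x y) (spectrum_one P).
- by apply: Qy; exact: spectrum_imp Qxy Qx.
- by apply: Rx; exact: spectrum_imp Rxy Ry.
Qed.

Lemma spectrum_is_sugihara_space :
  is_sugihara_space spectrum_Q spectrum_D spectrum_top.
Proof.
have topP : greatest spectrum_top by move=> P; apply/spectrum_leP.
have [Dc Do] : closed spectrum_D /\ open spectrum_D.
  have [? ?] := clopen_spectrum_basic (- t).
  by split; [exact: open_closedC|exact: closed_openC].
split=> //; last by split=> //; exact: spectrum_esakia.
split=> //.
- by split=> //; exact: spectrum_priestley.
- exact: closed_comparability spectrum_priestley.
- by move=> P; left.
- by move=> P Q [//|QP] DP; exact: spectrum_D_minimal.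
- move=> P Q R [PQ|QP] QR; first by right; exact: le_trans PQ QR.
  exact: spectrum_root_system QR QP.
Qed.

Lemma spectrum_top_notin_D : ~ spectrum_D spectrum_top.
Proof. by apply. Qed.

Definition spectrum_space : sugihara_space :=
  SugiharaSpace spectrum_is_sugihara_space spectrum_top_notin_D.

(** Two compactness arguments: covering the complement of [U] gives each point of [U] a basic set
    inside [U], and covering [U] by these gives a single one. *)
Lemma clopen_up_spectrum (U : set (spectrum A)) : clopen U -> up_set U ->
  U spectrum_top -> exists2 a, a <= t & U = [set P : spectrum A | P a].
Proof.
move=> [Uo Uc] Uup Utop.
have inner P : U P -> exists2 a, P a & [set Q : spectrum A | Q a] `<=` U.
  move=> UP; pose B (W : set (spectrum A)) :=
    exists2 a, P a & W = (~` [set Q : spectrum A | Q a])%classic.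
  have [|||||W [a Pa ->] UW] := @compact_directed_cover (spectrum A)
      (~` U)%classic B.
  - apply: closed_compact_priestley spectrum_priestley _ _.
    exact: open_closedC.
  - by move=> _ [a Pa ->]; apply: closed_openC; case: (clopen_spectrum_basic a).
  - exists t; first exact: spectrum_one.
    apply/esym; rewrite -subset0 => Q; apply; exact: spectrum_one.
  - move=> _ _ [a Pa ->] [b Pb ->]; exists (a `&` b); first exact/spectrum_meet.
    rewrite -setCI; congr (~` _)%classic; apply/predeqP => Q /=.
    by rewrite spectrum_meet.
  - move=> Q UQ; have /spectrum_nle[x Px Qx] : ~ P <= Q.
      by move=> PQ; apply: UQ; exact: Uup PQ UP.
    by exists (~` [set R : spectrum A | R x])%classic => //; exists x.
  exists a => // Q Qa; apply: contrapT => /UW; exact.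
have [a0 _ a0U] := inner _ Utop.
pose B (W : set (spectrum A)) := open W /\
  exists2 a, W `<=` [set Q : spectrum A | Q a] &
             [set Q : spectrum A | Q a] `<=` U.
have [|||||W [Wo [a Wa aU]] UW] := @compact_directed_cover (spectrum A) U B.
- exact: closed_compact_priestley spectrum_priestley _ _.
- by move=> W [].
- by split; [exact: open0|exists a0].
- move=> W V [Wo [a Wa aU]] [Vo [b Vb bU]]; split; first exact: openU.
  exists (a `|` b) => Q; first by case=> [/Wa|/Vb] ?; apply/spectrum_join; [left|right].
  by move=> /spectrum_join[/aU|/bU].
- move=> P /inner[a Pa aU]; exists [set Q : spectrum A | Q a] => //.
  by split; [exact: open_spectrum_basic|exists a].
(* Every point contains [t], so meeting with [t] keeps the basic set. *)
exists (a `&` t); first exact: leIr.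
apply/seteqP; split=> P /=; rewrite spectrum_meet.
  by move=> /UW/Wa Pa; split=> //; exact: spectrum_one.
by move=> [/aU].
Qed.

End spectrum_theory.

(** * Functoriality of the spectrum *)

Section spectrum_map.
Variables (A B : sugihara_monoid) (h : sm_hom A B).

Let hP := sm_homP h.

Lemma sm_hom_homo : {homo h : x y / x <= y}.
Proof. by move=> x y /meet_idPl xy; apply/meet_idPl; rewrite -(smh_meet hP) xy. Qed.

Lemma spectrum_map_subproof (P : spectrum B) :
  is_spectrum_point (spectrum_set P \o h).
Proof.
split; first split.
- by move=> x y /sm_hom_homo; exact: spectrum_up.
- by move=> x y Px Py; rewrite /= (smh_meet hP); apply/spectrum_meet.
- by rewrite /= (smh_one hP); exact: spectrum_one.
- by move=> x y; rewrite /= (smh_join hP) => /spectrum_join.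
Qed.

Definition spectrum_map (P : spectrum B) : spectrum A :=
  Spectrum (spectrum_map_subproof P).

Lemma spectrum_map_continuous : continuous spectrum_map.
Proof.
apply/continuousP => U Uo; rewrite spectrum_openE => P /Uo[a [o [[Pa Po] aU]]].
exists (h a), (omap h o); split=> [|Q [Qa Qo]].
  by split=> //; case: o Po {aU}.
by apply: aU; split=> //; case: o Qo {Po}.
Qed.

(* A prime filter above [P] that restricts to [Q] is found between the filter
   generated by [P] and the image of [Q], and the ideal generated by the image
   of the complement of [Q]. *)
Lemma spectrum_map_p_morphism : p_morphism spectrum_map.
Proof.
split=> [P Q /spectrum_leP PQ|P Q /spectrum_leP PQ].
  by apply/spectrum_leP => x; exact: PQ.
have PQ' x : P (h x) -> Q x by exact: PQ.
pose F := [set z : B | exists c a, [/\ P c, Q a & c `&` h a <= z]].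
pose I := [set z : B | exists2 b, ~ Q b & z <= h b].
have [||||R [FR IR]] := @spectrum_separation B F I.
- split=> [x y xy [c [a [Pc Qa cax]]]|x y [c [a [Pc Qa cx]]] [c' [a' [Pc' Qa' cy]]]].
    by exists c, a; split=> //; exact: le_trans xy.
  exists (c `&` c'), (a `&` a'); split; [exact/spectrum_meet|exact/spectrum_meet|].
  rewrite (smh_meet hP) lexI; apply/andP; split.
    by apply: le_trans cx; rewrite leI2 ?leIl.
  by apply: le_trans cy; rewrite leI2 ?leIr.
- split=> [x y xy [b Qb yb]|x y [b Qb xb] [b' Qb' yb]].
    by exists b => //; exact: le_trans yb.
  exists (b `|` b'); first by move=> /spectrum_join[].
  by rewrite (smh_join hP) leU2.
- exists sm_one, sm_one; split; [exact: spectrum_one|exact: spectrum_one|].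
  exact: leIl.
(* From [c /\ h a <= h b] the point [P] would contain [h (a /\ t ~~> b)], which forces [b] into
   [Q]. *)
- move=> z [c [a [Pc Qa caz]]] [b Qb zb]; apply: Qb.
  apply: (@spectrum_imp _ Q (a `&` sm_one)); last first.
    by apply/spectrum_meet; split=> //; exact: spectrum_one.
  apply: PQ'; apply: (@spectrum_up _ P (c `&` sm_one)); last first.
    by apply/spectrum_meet; split=> //; exact: spectrum_one.
  rewrite (smh_imp hP) (smh_meet hP) (smh_one hP) le_imps.
  apply: le_trans (muls_le_meet _ _) _; rewrite ?leIr //.
  by apply: le_trans zb; apply: le_trans caz; rewrite leI2 ?leIl.
exists R.
  apply/spectrum_leP => x Px; apply: FR; exists x, sm_one.
  by split=> //; [exact: spectrum_one|exact: leIl].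
apply: spectrum_eq => x; split=> [Rx|Qx].
  by apply: contrapT => Qx; apply: IR Rx; exists x.
apply: FR; exists sm_one, x.
by split=> //; [exact: spectrum_one|exact: leIr].
Qed.

Lemma spectrum_map_is_ss_hom :
  @is_ss_hom (spectrum_space B) (spectrum_space A) spectrum_map.
Proof.
have mapD P : spectrum_D (spectrum_map P) = spectrum_D P.
  by rewrite /spectrum_D /= (smh_neg hP) (smh_one hP).
split.
- exact: spectrum_map_continuous.
- exact: spectrum_map_p_morphism.
- exact: spectrum_eq.
- by move=> _ [P DP <-]; rewrite /= mapD.
- by move=> _ [P DP <-] /=; rewrite /setC /= mapD.
Qed.

Definition spectrum_hom : ss_hom (spectrum_space B) (spectrum_space A) :=
  SsHom spectrum_map_is_ss_hom.

End spectrum_map.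

(** * The dual algebra of a Sugihara space *)

(* In terms of the negative cone, an element [x] is encoded by the points where
   [x /\ t] and [- x /\ t] hold. *)
Record is_dual_elt (X : sugihara_space) (U V : set X) : Prop := IsDualElt {
  de_clopen1 : clopen U ; de_up1 : up_set U ; de_top1 : U ss_top ;
  de_clopen2 : clopen V ; de_up2 : up_set V ; de_top2 : V ss_top ;
  de_cover : forall p, U p \/ V p ;
  de_disj : forall p, U p -> V p -> ~ ss_D p }.

Record dual_elt (X : sugihara_space) := DualElt {
  dpos : set X ; dneg : set X ; dual_eltP : is_dual_elt dpos dneg }.

HB.instance Definition _ (X : sugihara_space) := gen_eqMixin (dual_elt X).
HB.instance Definition _ (X : sugihara_space) := gen_choiceMixin (dual_elt X).

Section dual_algebra.
Variable X : sugihara_space.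
Implicit Types (x y z : dual_elt X) (p q r : X).

Lemma dual_elt_eq x y : (forall p, dpos x p <-> dpos y p) ->
  (forall p, dneg x p <-> dneg y p) -> x = y.
Proof.
case: x y => [U V UV] [U' V' UV'] /= /predeqP eU /predeqP eV.
case: _ / eU UV'; case: _ / eV => UV'; congr DualElt; exact: Prop_irrelevance.
Qed.

Lemma ss_le_top p : p <= ss_top.
Proof. by have [_ [_ ltop] _ _] := ss_axioms X; exact: ltop. Qed.

Lemma ss_D_minimal p q : ss_D q -> p <= q -> p = q.
Proof.
have [K _ Qc _] := ss_axioms X => Dq pq; apply: le_anti; rewrite pq /=.
by apply: (pks_D_le K) => //; apply/Qc; right.
Qed.

(** The Kleene axiom on [Q] and [<=], with [Q] read as comparability, makes the points above any
    given point a chain. *)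
Lemma ss_root_system p q r : p <= q -> p <= r -> q <= r \/ r <= q.
Proof.
have [K _ Qc _] := ss_axioms X => pq pr; apply/or_comm/Qc.
by apply: (pks_Q_le K) _ pr; apply/Qc; right.
Qed.

Lemma clopen_ss_D : clopen (@ss_D X).
Proof. by have [K _ _ Do] := ss_axioms X; split=> //; exact: pks_D_closed K. Qed.

Lemma clopen_down (U : set X) : clopen U -> clopen (down_closure U).
Proof. by have [_ [[_ ce] _] _ _] := ss_axioms X; exact: ce. Qed.

Lemma dpos_up x p q : p <= q -> dpos x p -> dpos x q.
Proof. exact: (de_up1 (dual_eltP x)). Qed.

Lemma dneg_up x p q : p <= q -> dneg x p -> dneg x q.
Proof. exact: (de_up2 (dual_eltP x)). Qed.

Lemma dual_cover x p : dpos x p \/ dneg x p.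
Proof. exact: (de_cover (dual_eltP x)). Qed.

Lemma dual_disj x p : dpos x p -> dneg x p -> ~ ss_D p.
Proof. exact: (de_disj (dual_eltP x)). Qed.

Fact dual_display : Order.disp_t. Proof. exact: Order.Disp tt tt. Qed.

Definition dual_le x y := `[< (forall p, dpos x p -> dpos y p) /\
  (forall p, dneg y p -> dneg x p) >].

Lemma dual_le_refl : reflexive dual_le.
Proof. by move=> x; apply/asboolP. Qed.

Lemma dual_le_anti : antisymmetric dual_le.
Proof.
move=> x y /andP[/asboolP[pxy nxy] /asboolP[pyx nyx]].
by apply: dual_elt_eq => p; split; auto.
Qed.

Lemma dual_le_trans : transitive dual_le.
Proof.
move=> y x z /asboolP[pxy nxy] /asboolP[pyz nyz].
by apply/asboolP; split=> p; auto.
Qed.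

HB.instance Definition _ := Order.Le_isPOrder.Build dual_display (dual_elt X)
  dual_le_refl dual_le_anti dual_le_trans.

Lemma dual_leP x y : reflect ((forall p, dpos x p -> dpos y p) /\
  (forall p, dneg y p -> dneg x p)) (x <= y).
Proof. exact: asboolP. Qed.

Lemma up_setI (U V : set X) : up_set U -> up_set V -> up_set (U `&` V)%classic.
Proof. by move=> Uup Vup p q pq [/(Uup _ _ pq) ? /(Vup _ _ pq)]. Qed.

Lemma up_setU (U V : set X) : up_set U -> up_set V -> up_set (U `|` V)%classic.
Proof. by move=> Uup Vup p q pq [/(Uup _ _ pq)|/(Vup _ _ pq)]; [left|right]. Qed.

Lemma dual_neg_subproof x : is_dual_elt (dneg x) (dpos x).
Proof.
have [? ? ? ? ? ? c dj] := dual_eltP x.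
by split=> // p; [exact/or_comm|move=> /[swap]; exact: dj].
Qed.

Definition dual_neg x := DualElt (dual_neg_subproof x).

Lemma dual_negK x : dual_neg (dual_neg x) = x.
Proof. exact: dual_elt_eq. Qed.

Lemma dual_meet_subproof x y :
  is_dual_elt (dpos x `&` dpos y)%classic (dneg x `|` dneg y)%classic.
Proof.
have [? ? ? ? ? ? cx dx] := dual_eltP x; have [? ? ? ? ? ? cy dy] := dual_eltP y.
split=> //; [exact: clopenI|exact: up_setI|exact: clopenU|exact: up_setU|by left|..].
  by move=> p /=; have := cx p; have := cy p; rewrite /setI /setU /=; tauto.
by move=> p [xp yp] [nxp|nyp]; [exact: dx|exact: dy].
Qed.

Definition dual_meet x y := DualElt (dual_meet_subproof x y).

Definition dual_join x y := dual_neg (dual_meet (dual_neg x) (dual_neg y)).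

Lemma dual_meetP x y z : (x <= dual_meet y z) = (x <= y) && (x <= z).
Proof.
apply/dual_leP/andP => [[h1 h2]|[/dual_leP[p1 n1] /dual_leP[p2 n2]]].
  by split; apply/dual_leP; split=> p pp; try (by have [] := h1 p pp);
    apply: h2; [left|right].
by split=> p /= => [xp|[|]]; [split|..]; auto.
Qed.

Lemma dual_le_neg x y : (dual_neg x <= dual_neg y) = (y <= x).
Proof. by apply/dual_leP/dual_leP => -[]. Qed.

Lemma dual_joinP x y z : (dual_join x y <= z) = (x <= z) && (y <= z).
Proof. by rewrite -{1}(dual_negK z) dual_le_neg dual_meetP !dual_le_neg. Qed.

HB.instance Definition _ := Order.POrder_isMeetSemilattice.Build dual_display
  (dual_elt X) dual_meetP.
HB.instance Definition _ := Order.POrder_isJoinSemilattice.Build dual_display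
  (dual_elt X) dual_joinP.

Lemma dpos_meet x y p : dpos (x `&` y) p <-> dpos x p /\ dpos y p.
Proof. by []. Qed.

Lemma dneg_meet x y p : dneg (x `&` y) p <-> dneg x p \/ dneg y p.
Proof. by []. Qed.

Lemma dpos_join x y p : dpos (x `|` y) p <-> dpos x p \/ dpos y p.
Proof. by []. Qed.

Lemma dneg_join x y p : dneg (x `|` y) p <-> dneg x p /\ dneg y p.
Proof. by []. Qed.

Lemma dual_meetUl : @left_distributive (dual_elt X) _ Order.meet Order.join.
Proof.
move=> x y z; apply: dual_elt_eq => p.
  by rewrite !(dpos_join, dpos_meet); tauto.
by rewrite !(dneg_join, dneg_meet); tauto.
Qed.

HB.instance Definition _ := Order.Lattice_Meet_isDistrLattice.Build dual_display
  (dual_elt X) dual_meetUl.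

(** The complement of [D] is an up-set because the points of [D] are minimal; it contains the top by
    [ss_top_notin_D]. *)
Lemma dual_one_subproof : is_dual_elt [set: X] (~` ss_D)%classic.
Proof.
split=> //; first exact: clopenT.
- exact: (clopenC set0 clopen_ss_D).
- by move=> p q pq Dp Dq; apply: Dp; rewrite (ss_D_minimal Dq pq).
- exact: ss_top_notin_D.
- by left.
Qed.

Definition dual_one := DualElt dual_one_subproof.

(* Locally at a point [q] an element is positive ([~ dneg x q]), negative
   ([~ dpos x q]) or zero (both hold), and once nonzero it keeps its sign below
   [q]. A product is positive at [p] if at some [q] above [p] no factor is
   negative and some factor is positive. *)
Definition dual_mul_pos x y : set X := down_closure
  [set q | [/\ dpos x q, dpos y q & ~ (dneg x q /\ dneg y q)]].

Definition dzero x p := dpos x p /\ dneg x p.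

Lemma dual_mul_pos_zero x y p : dzero x p -> dzero y p -> ~ dual_mul_pos x y p.
Proof.
move=> [_ xp] [_ yp] [q [_ _]] nq pq; apply: nq.
by split; [exact: dneg_up xp|exact: dneg_up yp].
Qed.

Lemma dual_mul_pos_self x y p : dpos x p -> dpos y p ->
  dual_mul_pos x y p \/ dneg x p /\ dneg y p.
Proof.
move=> xp yp; have [?|h] := pselect (dneg x p /\ dneg y p); [by right|left].
by exists p.
Qed.

(** Clopenness comes from the Esakia condition, and the first component is an up-set because the
    points above a given one form a chain. *)
Lemma dual_mul_subproof x y : is_dual_elt
  ((dzero x `&` dzero y) `|` dual_mul_pos x y)%classic
  (~` dual_mul_pos x y)%classic.
Proof.
have [cx1 ux1 tx1 cx2 ux2 tx2 cx dx] := dual_eltP x.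
have [cy1 uy1 ty1 cy2 uy2 ty2 cy dy] := dual_eltP y.
have cS : clopen (dual_mul_pos x y).
  apply: clopen_down; have -> : [set q | [/\ dpos x q, dpos y q &
      ~ (dneg x q /\ dneg y q)]] = (dpos x `&` dpos y `&`
      ~` (dneg x `&` dneg y))%classic.
    by apply/predeqP => q; split=> [[]|[[]]].
  apply: clopenI; first exact: clopenI.
  by apply: (clopenC set0); exact: clopenI.
split.
- by apply: clopenU => //; apply: clopenI; exact: clopenI.
- move=> p r pr [[[? ?] [? ?]]|[q [xq yq nq] pq]].
    left; split; split; [exact: dpos_up pr _|exact: dneg_up pr _|
      exact: dpos_up pr _|exact: dneg_up pr _].
  (* Past the witness [q] both factors stay in their positive components, so at [r] the product is
     positive or both factors vanish. *)
  have [qr|rq] := ss_root_system pq pr; last by right; exists q.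
  have xr := dpos_up qr xq; have yr := dpos_up qr yq.
  by have [|[]] := dual_mul_pos_self xr yr; [right|left].
- by left.
- exact: (clopenC set0).
- move=> p q pq nSp [r Sr qr]; apply: nSp; exists r => //.
  exact: le_trans qr.
- exact: dual_mul_pos_zero.
- by move=> p; have [?|?] := pselect (dual_mul_pos x y p); [left; right|right].
- by move=> p [[[xp nxp] _]|//] _; exact: dx.
Qed.

Definition dual_mul x y := DualElt (dual_mul_subproof x y).

Lemma dposM x y p :
  dpos (dual_mul x y) p <-> (dzero x p /\ dzero y p) \/ dual_mul_pos x y p.
Proof. by []. Qed.

Lemma dnegM x y p : dneg (dual_mul x y) p <-> ~ dual_mul_pos x y p.
Proof. by []. Qed.

Lemma dzeroM x y p : dzero (dual_mul x y) p <-> dzero x p /\ dzero y p.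
Proof.
split=> [[[//|Sp] /dnegM//]|[xp yp]].
by split; [left|exact: dual_mul_pos_zero].
Qed.

(** By the cover condition [dpos] holds exactly at the zero and the positive points; products are
    easiest to compare in these two terms. *)
Lemma dual_elt_eq_zero x y : (forall p, dzero x p <-> dzero y p) ->
  (forall p, ~ dneg x p <-> ~ dneg y p) -> x = y.
Proof.
move=> zxy nxy; have nE p : dneg x p <-> dneg y p.
  by split=> np; apply: contrapT => /nxy.
have posE z p : dpos z p <-> dzero z p \/ ~ dneg z p.
  rewrite /dzero; split=> [zp|[[]//|nz]]; last by case: (dual_cover z p).
  by have [?|?] := pselect (dneg z p); [left|right].
by apply: dual_elt_eq => // p; rewrite !posE zxy nxy.
Qed.

Lemma dual_mul_pos_sym x y p : dual_mul_pos x y p -> dual_mul_pos y x p.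
Proof. by move=> [q [? ? nq] pq]; exists q => //; split=> // -[? ?]; apply: nq. Qed.

Lemma dual_mulC x y : dual_mul x y = dual_mul y x.
Proof.
apply: dual_elt_eq_zero => p; first by rewrite !dzeroM and_comm.
by rewrite !dnegM !not_notE; split; exact: dual_mul_pos_sym.
Qed.

(** The right side is symmetric in the three factors, so associativity follows from
    commutativity. *)
Lemma dual_mul_pos3 x y z p : dual_mul_pos (dual_mul x y) z p <->
  exists2 r, p <= r & [/\ dpos x r, dpos y r, dpos z r &
                          ~ [/\ dneg x r, dneg y r & dneg z r]].
Proof.
split=> [[q [[[[xq nxq] [yq nyq]]|[r [xr yr nr] qr]] zq nq] pq]|].
- exists q => //; split=> // -[_ _ zq']; apply: nq; split=> //.
  exact: dual_mul_pos_zero.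
- exists r; first exact: le_trans qr.
  by split=> //; [exact: dpos_up zq|case=> nxr nyr _; apply: nr].
- move=> [r pr [xr yr zr nr]]; exists r => //; split=> //.
    by have [|[]] := dual_mul_pos_self xr yr; [right|left].
  move=> [nS nzr]; apply: nr.
  by have [//|[]] := dual_mul_pos_self xr yr.
Qed.

Lemma dual_mulA x y z : dual_mul x (dual_mul y z) = dual_mul (dual_mul x y) z.
Proof.
rewrite (dual_mulC x); apply: dual_elt_eq_zero => p.
  by rewrite !dzeroM; tauto.
rewrite !dnegM !not_notE !dual_mul_pos3.
by split=> -[r pr [h1 h2 h3 nr]]; exists r => //; split=> // -[? ? ?]; apply: nr.
Qed.

Lemma dual_mulss x : dual_mul x x = x.
Proof.
apply: dual_elt_eq_zero => p; first by rewrite dzeroM; tauto.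
rewrite dnegM not_notE; split=> [[q [xq _ nq] pq] np|np].
  by apply: nq; split; exact: dneg_up np.
by exists p => //; case: (dual_cover x p) => // xp; split=> // -[].
Qed.

Lemma dual_mul1s x : dual_mul dual_one x = x.
Proof.
apply: dual_elt_eq_zero => p.
  rewrite dzeroM; split=> [[]//|xp]; split=> //; split=> //.
  by case: xp; exact: dual_disj.
rewrite dnegM not_notE; split=> [[q [_ xq nq] pq] np|np].
  have nxq := dneg_up pq np; apply: nq; split=> //.
  exact: dual_disj xq nxq.
by exists p => //; case: (dual_cover x p) => // xp; split=> // -[].
Qed.

(** Both sides say that [dual_mul_pos x y] is empty. With associativity this yields residuation. *)
Lemma dual_mul_le x y : (dual_mul x y <= dual_neg dual_one) = (x <= dual_neg y).
Proof.
apply/dual_leP/dual_leP => -[h1 h2].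
  have nS p : ~ dual_mul_pos x y p by exact: h2.
  split=> p /= pp; apply: contrapT => np; apply: (nS p).
    by exists p => //; split=> //; [case: (dual_cover y p)|case].
  by exists p => //; split=> //; [case: (dual_cover x p)|case].
have nS p : ~ dual_mul_pos x y p.
  by move=> [q [xq yq nq] _]; apply: nq; split; [exact: h2|exact: h1].
split=> p; last by move=> _; exact: nS.
by move=> [[[xp nxp] _]|/nS//]; exact: dual_disj xp nxp.
Qed.

Definition dual_imp x y := dual_neg (dual_mul x (dual_neg y)).

Lemma dual_is_sugihara_monoid :
  is_sugihara_monoid dual_mul dual_imp dual_one dual_neg.
Proof.
split.
- exact: dual_mulA.
- exact: dual_mulC.
- exact: dual_mul1s.
- move=> x y z; rewrite -{1}(dual_negK z) -dual_mul_le -dual_mulA.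
  by rewrite dual_mul_le.
- exact: dual_mulss.
- exact: dual_negK.
- by move=> x y; rewrite /dual_imp !dual_negK dual_mulC.
Qed.

Definition dual_algebra : sugihara_monoid :=
  SugiharaMonoid dual_is_sugihara_monoid.

End dual_algebra.

(** * Functoriality of the dual algebra *)

Section dual_map.
Variables (X Y : sugihara_space) (f : ss_hom X Y).

Let fP := ss_homP f.

Lemma ss_hom_D p : ss_D (f p) <-> ss_D p.
Proof.
split=> [Dfp|Dp]; last by apply: (ssh_D fP); exists p.
by apply: contrapT => Dp; apply: (ssh_notD fP) Dfp; exists p.
Qed.

Lemma preimage_clopen_ss_hom (U : set Y) : clopen U -> clopen (f @^-1` U).
Proof.
move=> [Uo Uc]; have fc := ssh_continuous fP; split.
  by move/continuousP: fc; apply.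
by apply: preimage_closed.
Qed.

Lemma preimage_up_ss_hom (U : set Y) : up_set U -> up_set (f @^-1` U).
Proof.
by move=> Uup p q pq; apply: Uup; have [fle _] := ssh_p_morphism fP; exact: fle.
Qed.

(** This is the p-morphism condition in terms of sets; it makes preimages compatible with products,
    which are built from a down-closure. *)
Lemma preimage_down_ss_hom (U : set Y) p :
  down_closure U (f p) <-> down_closure (f @^-1` U) p.
Proof.
have [fle fp] := ssh_p_morphism fP; split=> [[q Uq /fp[r pr rq]]|[q Uq pq]].
  by exists r => //; rewrite /preimage /= rq.
by exists (f q) => //; exact: fle.
Qed.

Lemma dual_map_subproof (x : dual_elt Y) :
  is_dual_elt (f @^-1` dpos x) (f @^-1` dneg x).
Proof.
have [? ? ? ? ? ? cx dx] := dual_eltP x.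
split; rewrite /preimage /= ?(ssh_top fP) //.
- exact: preimage_clopen_ss_hom.
- exact: preimage_up_ss_hom.
- exact: preimage_clopen_ss_hom.
- exact: preimage_up_ss_hom.
- by move=> p xp nxp /ss_hom_D; exact: dx.
Qed.

Definition dual_map (x : dual_elt Y) : dual_elt X :=
  DualElt (dual_map_subproof x).

Lemma dual_map_is_sm_hom : @is_sm_hom (dual_algebra Y) (dual_algebra X) dual_map.
Proof.
have mapM x y : dual_map (dual_mul x y) = dual_mul (dual_map x) (dual_map y).
  apply: dual_elt_eq_zero => p; first by rewrite dzeroM; exact: dzeroM.
  rewrite dnegM not_notE /= /preimage /= not_notE.
  exact: preimage_down_ss_hom.
have mapN x : dual_map (dual_neg x) = dual_neg (dual_map x).
  exact: dual_elt_eq.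
split=> [x y|x y|||| ].
- exact: dual_elt_eq.
- exact: dual_elt_eq.
- exact: mapM.
- by move=> x y; rewrite /= /dual_imp mapN mapM mapN.
- by apply: dual_elt_eq => // p; split=> np Dp; apply: np; apply/ss_hom_D.
- exact: mapN.
Qed.

Definition dual_hom : sm_hom (dual_algebra Y) (dual_algebra X) :=
  SmHom dual_map_is_sm_hom.

End dual_map.

(** * The duality *)

Lemma sm_hom_inverse (A B : sugihara_monoid) (f : sm_hom A B) :
  injective f -> (forall y, exists x, f x = y) ->
  exists g : sm_hom B A, cancel f g /\ cancel g f.
Proof.
move=> finj fsurj; have [fI fU fM fR f1 fN] := sm_homP f.
pose g y := sval (cid (fsurj y)).
have fgK : cancel g f by move=> y; exact: svalP (cid (fsurj y)).
have gP : is_sm_hom g.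
  split=> [x y|x y|x y|x y||x]; apply: finj; rewrite fgK.
  - by rewrite fI !fgK.
  - by rewrite fU !fgK.
  - by rewrite fM !fgK.
  - by rewrite fR !fgK.
  - by rewrite f1.
  - by rewrite fN !fgK.
by exists (SmHom gP); split=> // x; apply: finj; exact: fgK.
Qed.

Lemma ss_priestley (X : sugihara_space) : priestley_space X.
Proof. by have [[[]]] := ss_axioms X. Qed.

(** Reflecting the order gives injectivity, and a continuous bijection from a compact space to a
    Hausdorff space is closed, so its inverse is continuous. *)
Lemma ss_hom_inverse (X Y : sugihara_space) (f : ss_hom X Y) :
  (forall p q, f p <= f q -> p <= q) -> (forall q, exists p, f p = q) ->
  exists g : ss_hom Y X, cancel f g /\ cancel g f.
Proof.
move=> fle fsurj; have [fc [fhomo _] ftop _ _] := ss_homP f.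
have finj : injective f.
  by move=> p q fpq; apply: le_anti; rewrite !fle ?fpq.
pose g q := sval (cid (fsurj q)).
have fgK : cancel g f by move=> q; exact: svalP (cid (fsurj q)).
have gfK : cancel f g by move=> p; apply: finj; exact: fgK.
have gD q : ss_D (g q) <-> ss_D q by rewrite -(ss_hom_D f) fgK.
have gP : is_ss_hom g.
  split.
  - apply/continuousP => U Uo.
    have -> : g @^-1` U = (~` (f @` (~` U)))%classic.
      apply/predeqP => q; split=> [Ugq [p Up fpq]|nq].
        by apply: Up; rewrite -(gfK p) fpq.
      by apply: contrapT => Ugq; apply: nq; exists (g q).
    apply: closed_openC; apply: compact_closed.
      exact: priestley_hausdorff (ss_priestley Y).
    apply: continuous_compact; first exact: continuous_subspaceT.
    by apply: closed_compact_priestley (ss_priestley X) _ _; exact: open_closedC.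
  - split=> [p q pq|q p gqp]; first by apply: fle; rewrite !fgK.
    by exists (f p); rewrite ?gfK // -(fgK q); exact: fhomo.
  - by rewrite -ftop gfK.
  - by move=> _ [q Dq <-]; apply/gD.
  - by move=> _ [q Dq <-] /gD.
by exists (SsHom gP).
Qed.

(** * The isomorphism between a monoid and its double dual *)

Section unit.
Variable A : sugihara_monoid.

Lemma sm_unit_subproof (x : A) : @is_dual_elt (spectrum_space A)
  [set P : spectrum A | P x] [set P : spectrum A | P (sm_neg x)].
Proof.
split=> //; [exact: clopen_spectrum_basic|exact: up_set_spectrum_basic|
  exact: clopen_spectrum_basic|exact: up_set_spectrum_basic|..].
  by move=> P; exact: spectrum_em.
by move=> P Px Pnx; apply; exact: spectrum_neg_one Px Pnx.
Qed.

Definition sm_unit_fun (x : A) : dual_elt (spectrum_space A) :=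
  DualElt (sm_unit_subproof x).

(** For products, [spectrum_negM] computes the second component and [spectrum_mulE] the first. *)
Lemma sm_unit_is_sm_hom :
  @is_sm_hom A (dual_algebra (spectrum_space A)) sm_unit_fun.
Proof.
have unitN x : sm_unit_fun (sm_neg x) = dual_neg (sm_unit_fun x).
  by apply: dual_elt_eq => P //=; rewrite negsK.
have unitM x y : sm_unit_fun (sm_mul x y) =
    dual_mul (sm_unit_fun x) (sm_unit_fun y).
  have negM (P : spectrum A) : P (sm_neg (sm_mul x y)) <->
      ~ dual_mul_pos (sm_unit_fun x) (sm_unit_fun y) P.
    rewrite spectrum_negM; split=> [h [Q [Qx Qy nQ] PQ]|h Q PQ Qx Qy].
      by apply: nQ; exact: h.
    by apply: contrapT => nQ; apply: h; exists Q.
  apply: dual_elt_eq => P; last exact: negM.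
  rewrite dposM; apply: (iff_trans (spectrum_mulE P x y)).
  rewrite negM not_notE /dzero /=.
  by split=> [[[? ? ? ?]|?]|[[[? ?] [? ?]]|?]]; by [left|right].
split=> [x y|x y|||| ].
- apply: dual_elt_eq => P; first exact: spectrum_meet.
  by rewrite /= negs_meet spectrum_join.
- apply: dual_elt_eq => P; first exact: spectrum_join.
  by rewrite /= negs_join spectrum_meet.
- exact: unitM.
- by move=> x y; rewrite impsE unitN unitM unitN.
- apply: dual_elt_eq => P /=; first by split=> // _; exact: spectrum_one.
  by split=> [Pn|/contrapT//]; apply.
- exact: unitN.
Qed.

Definition sm_unit : sm_hom A (dual_algebra (spectrum_space A)) :=
  SmHom sm_unit_is_sm_hom.

Lemma sm_unit_inj : injective sm_unit.
Proof.
have le x y : sm_unit_fun x = sm_unit_fun y -> x <= y.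
  move=> exy; apply: spectrum_le_neg => P.
    suff : dpos (sm_unit_fun x) P -> dpos (sm_unit_fun y) P by [].
    by rewrite exy.
  suff : dneg (sm_unit_fun y) P -> dneg (sm_unit_fun x) P by [].
  by rewrite exy.
by move=> x y exy; apply: le_anti; rewrite !le.
Qed.

(* If [a] and [b] represent the two components of an element, the element is
   [a * - b]. *)
Lemma sm_unit_surj (u : dual_elt (spectrum_space A)) :
  exists x, sm_unit x = u.
Proof.
have [cU uU tU cV uV tV cov disj] := dual_eltP u.
have [a aone aU] := clopen_up_spectrum cU uU tU.
have [b bone bV] := clopen_up_spectrum cV uV tV.
rewrite aU bV in cov disj.
(* The cover and disjointness conditions on [u] become [a \/ b = t] and [a /\ b <= - t]. *)
have jab : a `|` b = sm_one.
  apply: le_anti; rewrite leUx aone bone /=.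
  by apply: spectrum_le_negative => // P _; apply/spectrum_join/cov.
have mab : a `&` b <= sm_neg sm_one.
  apply: spectrum_le_negative; first by rewrite leIxl.
  by move=> P /spectrum_meet[Pa Pb]; apply: contrapT => /(disj P Pa Pb).
have split1 c : c = sm_mul c a `|` sm_mul c b.
  by rewrite -muls_joinr jab muls1.
have mulab : sm_mul a b <= sm_neg sm_one by apply: le_trans mab; exact: muls_le_meet.
have xa (P : spectrum A) : P (sm_mul a (sm_neg b)) <-> P a.
  split=> [Px|]; last first.
    apply: spectrum_up; rewrite -{1}(mulss a) le_muls //.
    by rewrite le_negs.
  have : P (sm_mul a (sm_neg b) `&` sm_one).
    by apply/spectrum_meet; split=> //; exact: spectrum_one.
  (* Splitting along [a \/ b = t], one part is below [t * a] and the other below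
     [a * (- b * b) <= a * t]. *)
  apply: spectrum_up; rewrite [X in X <= _]split1 leUx; apply/andP; split.
    by rewrite -{3}(mul1s a) le_muls // leIr.
  apply: (@le_trans _ _ (sm_mul (sm_mul a (sm_neg b)) b)).
    by rewrite le_muls // leIl.
  rewrite -mulsA -{2}(muls1 a) le_muls // mulsC.
  exact: le_trans (muls_neg_le _) (neg_one_le _).
have xb (P : spectrum A) : P (sm_neg (sm_mul a (sm_neg b))) <-> P b.
  rewrite -impsE; split=> [Px|]; last first.
    apply: spectrum_up; rewrite le_imps -{2}(muls1 b).
    by rewrite le_muls.
  have : P (sm_imp a b `&` sm_one).
    by apply/spectrum_meet; split=> //; exact: spectrum_one.
  apply: spectrum_up; rewrite [X in X <= _]split1 leUx; apply/andP; split.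
    by rewrite -le_imps leIl.
  by rewrite -[X in _ <= X]mul1s le_muls // leIr.
exists (sm_mul a (sm_neg b)); apply: dual_elt_eq => P; rewrite ?aU ?bV.
  exact: xa.
exact: xb.
Qed.

End unit.

(** * The isomorphism between a space and its double dual *)

Section counit.
Variable X : sugihara_space.
Local Notation GX := (dual_algebra X).

Lemma ss_unit_subproof (p : X) :
  @is_spectrum_point GX [set x : dual_elt X | dpos x p].
Proof. by split=> //; split=> [x y /dual_leP[+ _]|]; [apply|]. Qed.

Definition ss_unit_fun (p : X) : spectrum GX := Spectrum (ss_unit_subproof p).

(* The element of the negative cone carried by [U]. *)
Lemma dual_negative_subproof (U : set X) : clopen U -> up_set U -> U ss_top ->
  is_dual_elt U (~` (U `&` ss_D))%classic.
Proof.
move=> Uc Uup Utop; split=> //.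
- by apply: (clopenC set0); apply: clopenI => //; exact: clopen_ss_D.
- by move=> p q pq np [Uq Dq]; apply: np; rewrite (ss_D_minimal Dq pq).
- by case=> _; exact: ss_top_notin_D.
- by move=> p; have [?|nU] := pselect (U p); [left|right=> -[]].
- by move=> p Up np Dp; apply: np.
Qed.

Lemma ss_unit_le p q : (ss_unit_fun p <= ss_unit_fun q) = (p <= q).
Proof.
apply/spectrum_leP/idP => [pq|pq x]; last exact: dpos_up.
apply: contrapT => /(ss_priestley X).2[U [Uc Uup Up Uq]]; apply: Uq.
have Utop : U ss_top by apply: Uup Up; exact: ss_le_top.
exact: (pq (DualElt (dual_negative_subproof Uc Uup Utop))).
Qed.

(** Meeting with the unit adds the complement of [D] to the second component, and a point where [y]
    is zero lies there. *)
Lemma dual_meet_one_le (x y : dual_elt X) :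
  (forall p, dpos x p -> dpos y p) -> x `&` dual_one X <= y.
Proof.
move=> xy; apply/dual_leP; split=> p => [[/xy]//|yp].
have [xp|nxp] := dual_cover x p; last by left.
by right; exact: dual_disj (xy _ xp) yp.
Qed.

(** The improper filter comes from the top. If a proper [P] came from no point, compactness would
    merge the local discrepancies into [x] in [P] and [y] outside [P] with [dpos x] inside [dpos y],
    so that [x /\ t <= y]. *)
Lemma ss_unit_surj (P : spectrum GX) : exists p, ss_unit_fun p = P.
Proof.
have [Pall|/existsNP[y0 Py0]] := pselect (forall x, P x).
  exists ss_top; apply: spectrum_eq => x; split=> // _.
  exact: (de_top1 (dual_eltP x)).
apply: contrapT => noP.
pose B (W : set X) := open W /\ exists x y : dual_elt X,
  [/\ P x, ~ P y & forall p, W p -> dpos x p -> dpos y p].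
have [|||||W [_ [x [y [Px Py Wxy]]]] TW] := @compact_directed_cover X setT B.
- exact: (ss_priestley X).1.
- by move=> W [].
- split; first exact: open0.
  by exists (dual_one X), y0; split=> //; exact: (@spectrum_one GX).
- move=> W V [Wo [x [y [Px Py Wxy]]]] [Vo [x' [y' [Px' Py' Vxy]]]].
  split; first exact: openU.
  exists (x `&` x'), (y `|` y'); split.
  + exact/(@spectrum_meet GX).
  + by move=> /(@spectrum_join GX)[].
  + by move=> p [/Wxy h|/Vxy h] [xp xp']; apply/dpos_join; [left|right]; apply: h.
- move=> p _; have [x nx] : exists x, ~ (dpos x p <-> P x).
    apply: contrapT => /forallNP h; apply: noP; exists p.
    by apply: spectrum_eq => x; exact: contrapT (h x).
  have [[xo xc] _ _ _ _ _ _ _] := dual_eltP x.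
  (* If [x] is in [P], the pair of [x] and [y0] works off [dpos x], where the inclusion is vacuous;
     otherwise the pair of the unit and [x] works on [dpos x]. *)
  have [Px|Px] := pselect (P x).
    have xp : ~ dpos x p by move=> xp; apply: nx.
    exists (~` dpos x)%classic => //; split; first exact: closed_openC.
    by exists x, y0.
  have xp : dpos x p by apply: contrapT => xp; apply: nx.
  exists (dpos x) => //; split=> //; exists (dual_one X), x.
  by split=> //; exact: (@spectrum_one GX).
apply: Py; apply: (@spectrum_up GX P (x `&` dual_one X)).
  by apply: dual_meet_one_le => p xp; apply: Wxy => //; exact: TW.
by apply/(@spectrum_meet GX); split=> //; exact: (@spectrum_one GX).
Qed.

Lemma ss_unit_is_ss_hom : @is_ss_hom X (spectrum_space GX) ss_unit_fun.
Proof.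
split.
- apply/continuousP => U Uo; rewrite openE => p /Uo[a [o [[pa po] aU]]].
  rewrite /interior nbhsE.
  exists (dpos (a : dual_elt X) `&`
    (if o is Some b then ~` dpos (b : dual_elt X) else setT))%classic.
    have [[ao _] _ _ _ _ _ _ _] := dual_eltP a.
    case: o po {aU} => [b|] /= pb; split=> //; apply: openI => //; last exact: openT.
    by have [[_ bc] _ _ _ _ _ _ _] := dual_eltP b; exact: closed_openC.
  by move=> q [aq oq]; apply: aU; split=> //; case: o oq {po}.
- split=> [p q pq|p Q]; first by rewrite ss_unit_le.
  by have [q <-] := ss_unit_surj Q => pq; exists q => //; rewrite -ss_unit_le.
- by apply: spectrum_eq => x; split=> // _; exact: (de_top1 (dual_eltP x)).
(* The negated unit has the complement of [D] as first component, so both claims unfold to double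
   negations. *)
- by move=> _ [p Dp <-]; apply.
- by move=> _ [p Dp <-]; apply.
Qed.

Definition ss_unit : ss_hom X (spectrum_space GX) := SsHom ss_unit_is_ss_hom.

End counit.

(** * The two functors and the equivalence *)

Lemma spectrum_hom_id (A : sugihara_monoid) :
  spectrum_hom (sm_id A) = ss_id (spectrum_space A).
Proof. by apply: ss_hom_eq => P; exact: spectrum_eq. Qed.

Lemma spectrum_hom_comp (A B C : sugihara_monoid) (f : sm_hom B A)
    (g : sm_hom C B) :
  spectrum_hom (sm_comp f g) = ss_comp (spectrum_hom g) (spectrum_hom f).
Proof. by apply: ss_hom_eq => P; exact: spectrum_eq. Qed.

Definition spectrum_functor : functor (opposite SM) pSS :=
  @Functor (opposite SM) pSS spectrum_space (fun A B f => spectrum_hom f)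
    spectrum_hom_id (fun A B C f g => spectrum_hom_comp g f).

Lemma dual_hom_id (X : sugihara_space) :
  dual_hom (ss_id X) = sm_id (dual_algebra X).
Proof. by apply: sm_hom_eq => x; exact: dual_elt_eq. Qed.

Lemma dual_hom_comp (X Y Z : sugihara_space) (f : ss_hom Y Z) (g : ss_hom X Y) :
  dual_hom (ss_comp f g) = sm_comp (dual_hom g) (dual_hom f).
Proof. by apply: sm_hom_eq => x; exact: dual_elt_eq. Qed.

Definition dual_functor : functor pSS (opposite SM) :=
  @Functor pSS (opposite SM) dual_algebra (fun X Y f => dual_hom f)
    dual_hom_id dual_hom_comp.

Lemma naturally_isomorphic_sym (C D : category) (F G : functor C D) :
  naturally_isomorphic F G -> naturally_isomorphic G F.
Proof.
move=> [eta [nat iso]]; pose inv a := sval (cid (iso a)).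
have invP a : comp (inv a) (eta a) = idm _ /\ comp (eta a) (inv a) = idm _.
  exact: svalP (cid (iso a)).
exists inv; split=> [a b f|a]; last by exists (eta a); have [] := invP a.
have [_ ra] := invP a; have [lb _] := invP b.
by rewrite -[LHS]compm1 -ra -compA (compA (fmap G f)) -nat !compA lb comp1m.
Qed.

Theorem mainTheorem1 : dually_equivalent SM pSS.
Proof.
exists spectrum_functor, dual_functor; split.
  (* In the opposite category [sm_unit] runs from the double dual to the monoid, as required. *)
  exists sm_unit; split=> [A B f|A].
    apply: sm_hom_eq => x; apply: dual_elt_eq => P //=.
    by rewrite (smh_neg (sm_homP f)).
  have [g [gK Kg]] := sm_hom_inverse (@sm_unit_inj A) (@sm_unit_surj A).
  by exists g; split; apply: sm_hom_eq => x; [exact: Kg|exact: gK].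
(* [ss_unit] runs from the space to its double dual, so the isomorphism is reversed. *)
apply: naturally_isomorphic_sym; exists ss_unit; split=> [X Y f|X].
  by apply: ss_hom_eq => p; exact: spectrum_eq.
have [p q|g [gK Kg]] := ss_hom_inverse (f := ss_unit X) _ (@ss_unit_surj X).
  by rewrite ss_unit_le.
by exists g; split; apply: ss_hom_eq => p; [exact: gK|exact: Kg].
Qed.
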